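(* Let $G=(V,E)$ be a nonempty simple graph with no isolated vertices such that $\Delta(G)\ge 2\,\mathrm{ad}(G)$. Then the number of $\Delta(G)$-weak edges in $G$ is at least $\frac{|E|}{2\,\mathrm{ad}(G)^2}$.
   Context: $\Delta(G)$ is the maximum degree and $\mathrm{ad}(G)=\frac{1}{|V|}\sum_{v\in V}d(v)$ the average degree of $G$. For an integer $D$ and a vertex $u$, $d^D(u)$ denotes the number of neighbors of $u$ of degree exactly $D$. For a statement $P$, $[P]$ is $1$ if $P$ holds and $0$ otherwise. An edge $uv$ is $(D,u)$-weak if $d^D(u)\le D-d(v)+[d(v)=D]$, and $uv$ is $D$-weak if it is $(D,u)$-weak or $(D,v)$-weak. *)

(* Defs.v *)
From mathcomp Require Import all_boot all_order all_algebra.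

Set Implicit Arguments.
Unset Strict Implicit.
Unset Printing Implicit Defensive.

Import Order.TTheory GRing.Theory Num.Theory.
Local Open Scope ring_scope.

(* A finite simple graph is a symmetric irreflexive relation
   [e] on a finType of vertices. *)

Definition nbrs (T : finType) (e : rel T) (u : T) : {set T} :=
  [set v | e u v].

Definition deg (T : finType) (e : rel T) (u : T) : nat := #|nbrs e u|.

Definition max_deg (T : finType) (e : rel T) : nat := \max_(v : T) deg e v.

Definition avg_deg (T : finType) (e : rel T) : rat :=
  (\sum_(v : T) (deg e v)%:R) / #|T|%:R.

Definition edges (T : finType) (e : rel T) : {set {set T}} :=
  [set [set u; v] | u in T, v in nbrs e u].

Definition deg_exact (T : finType) (e : rel T) (D : int) (u : T) : nat :=
  #|[set w in nbrs e u | (deg e w)%:Z == D]|.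

(* [weak_at e D u v] says that uv is (D,u)-weak: it compares the number of
   degree-D neighbours of u with D - d(v) + [d(v) = D].  It is stated in [int]
   so that the subtraction is not truncated. *)
Definition weak_at (T : finType) (e : rel T) (D : int) (u v : T) : bool :=
  (deg_exact e D u)%:Z <= D - (deg e v)%:Z + ((deg e v)%:Z == D)%:Z.

Definition weak_edges (T : finType) (e : rel T) (D : int) : {set {set T}} :=
  [set [set u; v] | u in T, v in nbrs e u
                    & weak_at e D u v || weak_at e D v u].

(* Main.v *)
Require Import Defs.
From mathcomp Require Import all_boot all_order all_algebra.
From mathcomp Require Import zify lra.

(* Discharging.  Write D for the maximum degree and give each vertex v the
   charge 2 d(v).  Call u small if 2 d(u) <= D, and let every vertex send
   (D - 1) / (d(u) - 1) to each small neighbour u joined to it by a non-weak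
   edge.  If w sends something and d is the least degree of its recipients,
   non-weakness yields at least D - d + 1 neighbours of degree D, hence at most
   d(w) - D + d - 1 recipients, so that w keeps at least D + 1.  A small vertex
   incident with k weak edges ends with at least D + 1 - k D.  Summing,
   |V| (D + 1) <= 2 |V| ad + 2 D W with W the number of weak edges, and
   D >= 2 ad turns this into W >= |V| / (4 ad) = |E| / (2 ad^2). *)

Set Implicit Arguments.
Unset Strict Implicit.
Unset Printing Implicit Defensive.

Import Order.TTheory GRing.Theory Num.Theory.
Local Open Scope ring_scope.

Lemma set2_eqP (T : finType) (a b u v : T) :
  [set a; b] = [set u; v] -> (a, b) = (u, v) \/ (a, b) = (v, u).
Proof.
move=> eq_ab.
have: u \in [set a; b] by rewrite eq_ab set21.
have: v \in [set a; b] by rewrite eq_ab set22.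
have: a \in [set u; v] by rewrite -eq_ab set21.
have: b \in [set u; v] by rewrite -eq_ab set22.
rewrite !inE => /orP[]/eqP-> /orP[]/eqP-> /orP[]/eqP E1 /orP[]/eqP E2;
  by subst; auto.
Qed.

(** Each edge is the image of exactly two ordered pairs, distinct by irreflexivity. The relation is
    arbitrary so that the count serves both [e] and its weak part. *)
Lemma handshake (T : finType) (r : rel T) :
  symmetric r -> irreflexive r ->
  (\sum_v deg r v = 2 * #|edges r|)%N.
Proof.
move=> r_sym r_irr.
pose h (p : T * T) : {set T} := [set p.1; p.2].
pose P : {set T * T} := [set p | r p.1 p.2].
have -> : edges r = h @: P.
  apply/setP => A; apply/imset2P/imsetP.
    by case=> u v _; rewrite inE => ruv ->; exists (u, v); rewrite ?inE.
  by case=> -[u v]; rewrite inE /= => ruv ->; exists u v; rewrite ?inE.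
have -> : (\sum_v deg r v = \sum_(p in P) 1)%N.
  rewrite (eq_bigr (fun v => \sum_(u | r v u) 1)%N); last first.
    by move=> v _; rewrite /deg -sum1_card; apply: eq_bigl => u; rewrite inE.
  by rewrite pair_big_dep; apply: eq_bigl => p; rewrite inE.
rewrite (partition_big_imset h) /= mulnC -sum_nat_const.
apply: eq_bigr => A /imsetP[[u v]]; rewrite inE /= => ruv ->.
have uv : (u, v) != (v, u).
  by apply/eqP => -[E _]; rewrite E r_irr in ruv.
rewrite sum1_card -(eq_card (A := [set (u, v); (v, u)])) ?cards2 ?uv//.
move=> [a b]; rewrite /h !inE [RHS]inE /= inE /=.
apply/orP/andP => [[]/eqP[-> ->]|[_ /eqP/set2_eqP[]->]]; auto.
by rewrite r_sym setUC.
Qed.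

Section Discharging.
Variables (T : finType) (e : rel T).
Hypotheses (e_sym : symmetric e) (e_irrefl : irreflexive e).
Hypothesis no_isolated : forall v : T, (0 < deg e v)%N.

Let D := max_deg e.
Let weak u v := weak_at e D u v || weak_at e D v u.
Let weak_rel u v := e u v && weak u v.
Let strong_rel u v := e u v && ~~ weak u v.
Let small u := (2 * deg e u <= D)%N.

Lemma deg_le_max v : (deg e v <= D)%N.
Proof. exact: leq_bigmax. Qed.

Lemma strong_sym : symmetric strong_rel.
Proof. by move=> u v; rewrite /strong_rel /weak e_sym orbC. Qed.

(** The bracket [[d(v) = D]] secures the second bound when [d(v) = D]; otherwise [D - d(v)] is
    already at least 1. *)
Lemma strong_deg_exact u v : strong_rel u v ->
  (D < deg_exact e D u + deg e v)%N /\ (1 < deg_exact e D u)%N.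
Proof.
case/andP=> _; rewrite negb_or => /andP[+ _].
rewrite /weak_at -ltNge; have := deg_le_max v; rewrite eqz_nat.
by case: eqP => /=; lia.
Qed.

Lemma deg_exact_le u : (deg_exact e D u <= deg e u)%N.
Proof. by apply: subset_leq_card; apply/subsetP => x; rewrite inE => /andP[]. Qed.

Lemma weak_edgesE : weak_edges e D = edges weak_rel.
Proof.
apply/setP => A; apply/imset2P/imset2P; case=> u v _.
- by rewrite !inE => /andP[euv wuv] ->; exists u v; rewrite // inE; apply/andP.
- rewrite inE => /andP[euv wuv] ->; exists u v; rewrite // !inE.
  by apply/andP.
Qed.

Lemma deg_split u : deg e u = (deg weak_rel u + deg strong_rel u)%N.
Proof.
rewrite /deg -(cardsID [set v | weak u v]).
by congr (_ + _)%N; apply: eq_card => v; rewrite !inE ?(andbC (~~ _)).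
Qed.

(** The first branch never divides by zero: a strong edge at [u] gives [u] at least two neighbours
    of degree [D]. *)
Let sent (w u : T) : rat :=
  if strong_rel w u && small u then (D%:R - 1) / ((deg e u)%:R - 1) else 0.

Lemma sent_out w : \sum_u sent w u + (D%:R + 1) <= 2 * (deg e w)%:R
  \/ small w /\ \sum_u sent w u = 0.
Proof.
have Dw := deg_le_max w.
have d0 := no_isolated w.
rewrite -big_mkcond /=.
case: (pickP (fun u => strong_rel w u && small u)) => [u0 P0|none]; last first.
  rewrite big_pred0 //; case: (leqP (2 * deg e w) D) => [sw|lw]; first by right.
  by left; rewrite add0r natr1 -natrM ler_nat; lia.
left.
(* The recipient of least degree receives the largest share [c], which bounds all the others. *)
case: (@arg_minnP T u0 [pred u | strong_rel w u && small u] (deg e) P0) => /= u /andP[wu su] umin.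
have [h1 h2] := strong_deg_exact wu.
have [_ h3] : (D < deg_exact e D u + deg e w)%N /\ (1 < deg_exact e D u)%N.
  by apply: strong_deg_exact; rewrite strong_sym.
have d1 : (1 < deg e u)%N := leq_trans h3 (deg_exact_le u).
set s := #|[set v | strong_rel w v && small v]|.
have sD : (s + deg_exact e D w <= deg e w)%N.
  rewrite /s /deg_exact -cardsUI.
  (* No small vertex has degree [D], since [D > 0]; the two sets of neighbours are disjoint. *)
  rewrite [X in (_ + X)%N](_ : _ = 0)%N ?addn0; last first.
    apply/eqP; rewrite cards_eq0; apply/eqP/setP => v; rewrite !inE eqz_nat.
    apply/negP => /andP[/andP[_ sv] /andP[_ /eqP vD]].
    by move: sv; rewrite /small vD; lia.
  apply: subset_leq_card; apply/subsetP => v; rewrite !inE.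
  by case/orP=> /andP[] // /andP[].
pose c : rat := (D%:R - 1) / ((deg e u)%:R - 1).
have dR : (2 <= (deg e u)%:R :> rat) by rewrite (ler_nat _ 2).
have sR : 2 * (deg e u)%:R <= D%:R :> rat by rewrite -natrM ler_nat.
have sum_le : \sum_(v | strong_rel w v && small v)
    (D%:R - 1) / ((deg e v)%:R - 1) <= c *+ s.
  rewrite -sumr_const (eq_bigl (fun v => v \in [set v | strong_rel w v && small v]));
    last by move=> v; rewrite inE.
  apply: ler_sum => v; rewrite inE => Pv.
  have := umin v Pv; rewrite -(ler_nat rat) => uv.
  apply: ler_wpM2l; first lra.
  by rewrite lef_pV2 ?posrE; lra.
have c2 : 2 <= c by rewrite /c ler_pdivlMr; lra.
have cE : c * ((deg e u)%:R - 1) = D%:R - 1 by rewrite /c divfK //; lra.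
have sN : (s + D + 1 <= deg e w + deg e u)%N by lia.
have {sN}: s%:R + D%:R + 1 <= (deg e w)%:R + (deg e u)%:R :> rat.
  by rewrite -!natrD natr1 ler_nat -addn1.
(* With [d = deg e u]: [c * s <= c * (d - 1) - c * (D - deg e w) <= D - 1 - 2 * (D - deg e w)], by
   [c >= 2] and [deg e w <= D]. *)
move: sum_le; rewrite -mulr_natr => sum_le sN.
have : (deg e w)%:R <= D%:R :> rat by rewrite ler_nat.
nra.
Qed.

Lemma sent_in u : small u ->
  D%:R + 1 <= 2 * (deg e u)%:R + \sum_w sent w u + D%:R * (deg weak_rel u)%:R.
Proof.
move=> su; pose c : rat := (D%:R - 1) / ((deg e u)%:R - 1).
have -> : \sum_w sent w u = c * (deg strong_rel u)%:R.
  rewrite mulr_natr -sumr_const -big_mkcond; apply: eq_bigl => w.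
  by rewrite su andbT inE strong_sym.
have d0 := no_isolated u.
have dE := deg_split u.
have sR : 2 * (deg e u)%:R <= D%:R :> rat by rewrite -natrM ler_nat.
(* For a leaf [u], [c] is 0 by the convention on division, but its only edge is weak and the term in
   [D] suffices. *)
case: (ltnP 1 (deg e u)) => d1; last first.
  have [k1|[s1 k0]] : deg weak_rel u = 1%N \/
      deg strong_rel u = 1%N /\ deg weak_rel u = 0%N by lia.
    have -> : deg strong_rel u = 0%N by lia.
    have : (1 <= (deg e u)%:R :> rat) by rewrite (ler_nat _ 1).
    by rewrite k1 mulr1 mulr0; lra.
  have /card_gt0P[w] : (0 < #|nbrs strong_rel u|)%N by rewrite -/(deg _ _) s1.
  rewrite inE => /strong_deg_exact[_ h].
  by have := leq_trans h (deg_exact_le u); lia.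
have dR : (2 <= (deg e u)%:R :> rat) by rewrite (ler_nat _ 2).
have c2 : 2 <= c by rewrite /c ler_pdivlMr; lra.
have cE : c * ((deg e u)%:R - 1) = D%:R - 1.
  by rewrite /c divfK // gt_eqF //; lra.
have cD : c <= D%:R - 1 by nra.
have dER : (deg e u)%:R = (deg weak_rel u)%:R + (deg strong_rel u)%:R :> rat.
  by rewrite -natrD -dE.
(* Without weak edges, [u] receives [c * deg e u = D - 1 + c >= D + 1]. *)
case: (posnP (deg weak_rel u)) => [k0|].
  by rewrite k0 in dER *; nra.
rewrite -(ler_nat rat) => k1.
(* One weak edge still leaves [c * (deg e u - 1) = D - 1] received; each further one costs
   [c <= D]. *)
have ck : c * ((deg weak_rel u)%:R - 1) <= D%:R * ((deg weak_rel u)%:R - 1).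
  by apply: ler_wpM2r; lra.
by rewrite dER in cE sR *; nra.
Qed.

Lemma weak_edges_count :
  #|T|%:R * (D%:R + 1)
    <= 2 * (\sum_v (deg e v)%:R) + 2 * D%:R * #|weak_edges e D|%:R :> rat.
Proof.
have weak_sum : \sum_v (deg weak_rel v)%:R = 2 * #|weak_edges e D|%:R :> rat.
  rewrite -natr_sum handshake ?weak_edgesE ?natrM//.
    by move=> u v; rewrite /weak_rel /weak e_sym orbC.
  by move=> u; rewrite /weak_rel e_irrefl.
have final v : D%:R + 1 <= 2 * (deg e v)%:R - \sum_u sent v u
    + \sum_w sent w v + D%:R * (deg weak_rel v)%:R.
  have in_ge0 : 0 <= \sum_w sent w v.
    apply: sumr_ge0 => w _; rewrite /sent; case: ifP => // _.
    have d1 : (1 <= (deg e v)%:R :> rat) by rewrite (ler_nat _ 1).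
    have : (deg e v)%:R <= D%:R :> rat by rewrite ler_nat deg_le_max.
    by move=> dD; apply: divr_ge0; lra.
  have k_ge0 : 0 <= D%:R * (deg weak_rel v)%:R :> rat by rewrite -natrM ler0n.
  case: (sent_out v) => [out|[sv ->]]; first lra.
  by have := sent_in sv; lra.
have := ler_sum (index_enum T) (fun v (_ : xpredT v) => final v).
(* Charge sent and charge received cancel in the total. *)
rewrite sumr_const !big_split /= sumrN [X in _ - X]exchange_big /=.
by rewrite -!mulr_sumr weak_sum -mulr_natl; lra.
Qed.

End Discharging.

Theorem theorem3 (T : finType) (e : rel T)
  (e_sym : symmetric e) (e_irrefl : irreflexive e)
  (nonempty : (0 < #|T|)%N)
  (no_isolated : forall v : T, (0 < deg e v)%N)
  (max_ge : 2 * avg_deg e <= (max_deg e)%:R) :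
  #|edges e|%:R / (2 * avg_deg e ^+ 2) <= #|weak_edges e (max_deg e)%:Z|%:R.
Proof.
have count := weak_edges_count e_sym e_irrefl no_isolated.
have n0 : 0 < #|T|%:R :> rat by rewrite ltr0n.
have sumE : \sum_v (deg e v)%:R = avg_deg e * #|T|%:R :> rat.
  by rewrite /avg_deg divfK // gt_eqF.
have edgesE : 2 * #|edges e|%:R = avg_deg e * #|T|%:R :> rat.
  by rewrite -sumE -natr_sum handshake // natrM.
have a1 : 1 <= avg_deg e.
  rewrite /avg_deg ler_pdivlMr // mul1r -natr_sum ler_nat -sum1_card.
  by apply: leq_sum => v _; apply: no_isolated.
rewrite {}sumE in count.
move: (avg_deg e) (max_deg e)%:R #|weak_edges _ _|%:R #|edges e|%:R #|T|%:R
  => a D W m n in max_ge count n0 edgesE a1 *.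
have n_le : n <= 4 * a * W.
  have D0 : 0 < D by lra.
  rewrite -(ler_pM2l D0).
  (* After [count] is multiplied by [2 * a], what remains to be shown is exactly
     [n * (D - 2 * a) * (2 * a - 1) >= 0]. *)
  have := mulr_ge0 (mulr_ge0 (ltW n0) (_ : 0 <= D - 2 * a)) (_ : 0 <= 2 * a - 1).
  move=> /(_ ltac:(lra) ltac:(lra)) key.
  have a2 : 0 <= 2 * a by lra.
  by have := ler_wpM2l a2 count; lra.
rewrite ler_pdivrMr; last by nra.
have a0 : 0 <= a by lra.
by have := ler_wpM2l a0 n_le; lra.
Qed.
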